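(* The systems $\mathsf{S_{RBL}}$ and $\mathsf{S^*_{RBL}}$ are equivalent: a sequent $A\Rightarrow B$ (with $A,B$ formulas of $\mathcal{L}_{\mathrm{RBL}}$) is derivable in $\mathsf{S_{RBL}}$ if and only if it is derivable in $\mathsf{S^*_{RBL}}$.
   Context: $\mathcal{L}_{\mathrm{RBL}}$-formulas are built from propositional letters $p$ and constants $\bot,\top$ by the binary connectives $\wedge,\vee,\cdot,\rightarrow,\leftarrow$. Sequents are expressions $A\Rightarrow B$ with $A,B$ formulas. The system $\mathsf{S_{RBL}}$ has the axioms: $A\Rightarrow A$; $\bot\Rightarrow A$; $A\Rightarrow\top$; $A\wedge(B\vee C)\Rightarrow (A\wedge B)\vee(A\wedge C)$; $(\mathrm{W}_l)$ $A\cdot\top\Rightarrow A$; $(\mathrm{W}_r)$ $\top\cdot A\Rightarrow A$; $(\mathrm{RC})$ $A\cdot B\Rightarrow (A\cdot B)\cdot B$; and the rules: Cut (from $A\Rightarrow B$ and $B\Rightarrow C$ infer $A\Rightarrow C$); residuation rules: from $A\cdot B\Rightarrow C$ infer $B\Rightarrow A\rightarrow C$ and conversely; from $A\cdot B\Rightarrow C$ infer $A\Rightarrow C\leftarrow B$ and conversely; from $A_i\Rightarrow B$ infer $A_1\wedge A_2\Rightarrow B$ ($i=1,2$); from $C\Rightarrow A$ and $C\Rightarrow B$ infer $C\Rightarrow A\wedge B$; from $A\Rightarrow C$ and $B\Rightarrow C$ infer $A\vee B\Rightarrow C$; from $C\Rightarrow A_i$ infer $C\Rightarrow A_1\vee A_2$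 ($i=1,2$). The system $\mathsf{S^*_{RBL}}$ is obtained from $\mathsf{S_{RBL}}$ by replacing the three axioms $(\mathrm{W}_l)$, $(\mathrm{W}_r)$, $(\mathrm{RC})$ respectively by the axioms $\top\Rightarrow A\rightarrow A$; $A\Rightarrow\top\rightarrow A$; $(A\rightarrow B)\wedge(B\rightarrow C)\Rightarrow A\rightarrow C$. *)

(* Defs.v *)
Set Implicit Arguments.

Inductive formula (V : Type) : Type :=
| Var : V -> formula V
| Bot : formula V
| Top : formula V
| And : formula V -> formula V -> formula V
| Or : formula V -> formula V -> formula V
| Prod : formula V -> formula V -> formula V
| Rarr : formula V -> formula V -> formula V
| Larr : formula V -> formula V -> formula V.

Arguments Bot {V}.
Arguments Top {V}.

Declare Scope rbl_scope.
Delimit Scope rbl_scope with rbl.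
Bind Scope rbl_scope with formula.

Notation "⊥" := Bot : rbl_scope.
Notation "⊤" := Top : rbl_scope.
Notation "A ⋅ B" := (Prod A B) (at level 40, left associativity) : rbl_scope.
Notation "A ∧ B" := (And A B) (at level 50, left associativity) : rbl_scope.
Notation "A ∨ B" := (Or A B) (at level 50, left associativity) : rbl_scope.
Notation "A → B" := (Rarr A B) (at level 60, no associativity) : rbl_scope.
(* In [C ← B] the second argument is the antecedent. *)
Notation "A ← B" := (Larr A B) (at level 60, no associativity) : rbl_scope.

Inductive sequent (V : Type) : Type :=
| Seq : formula V -> formula V -> sequent V.

Notation "A ⇒ B" := (Seq A%rbl B%rbl) (at level 70, no associativity) : rbl_scope.
Bind Scope rbl_scope with sequent.

Local Open Scope rbl_scope.

(* The part common to both systems, over a set [Ax] of additional axioms. *)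
Inductive derivable (V : Type) (Ax : sequent V -> Prop) : sequent V -> Prop :=
| d_ax s : Ax s -> derivable Ax s
| d_id A : derivable Ax (A ⇒ A)
| d_bot A : derivable Ax (⊥ ⇒ A)
| d_top A : derivable Ax (A ⇒ ⊤)
| d_distr A B C : derivable Ax (A ∧ (B ∨ C) ⇒ (A ∧ B) ∨ (A ∧ C))
| d_cut A B C :
    derivable Ax (A ⇒ B) -> derivable Ax (B ⇒ C) -> derivable Ax (A ⇒ C)
| d_res_r A B C : derivable Ax (A ⋅ B ⇒ C) -> derivable Ax (B ⇒ A → C)
| d_res_r_inv A B C : derivable Ax (B ⇒ A → C) -> derivable Ax (A ⋅ B ⇒ C)
| d_res_l A B C : derivable Ax (A ⋅ B ⇒ C) -> derivable Ax (A ⇒ C ← B)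
| d_res_l_inv A B C : derivable Ax (A ⇒ C ← B) -> derivable Ax (A ⋅ B ⇒ C)
| d_and_l1 A1 A2 B : derivable Ax (A1 ⇒ B) -> derivable Ax (A1 ∧ A2 ⇒ B)
| d_and_l2 A1 A2 B : derivable Ax (A2 ⇒ B) -> derivable Ax (A1 ∧ A2 ⇒ B)
| d_and_r A B C :
    derivable Ax (C ⇒ A) -> derivable Ax (C ⇒ B) -> derivable Ax (C ⇒ A ∧ B)
| d_or_l A B C :
    derivable Ax (A ⇒ C) -> derivable Ax (B ⇒ C) -> derivable Ax (A ∨ B ⇒ C)
| d_or_r1 A1 A2 C : derivable Ax (C ⇒ A1) -> derivable Ax (C ⇒ A1 ∨ A2)
| d_or_r2 A1 A2 C : derivable Ax (C ⇒ A2) -> derivable Ax (C ⇒ A1 ∨ A2).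

Inductive ax_RBL (V : Type) : sequent V -> Prop :=
| ax_Wl A : ax_RBL (A ⋅ ⊤ ⇒ A)
| ax_Wr A : ax_RBL (⊤ ⋅ A ⇒ A)
| ax_RC A B : ax_RBL (A ⋅ B ⇒ (A ⋅ B) ⋅ B).

Inductive ax_RBL_star (V : Type) : sequent V -> Prop :=
| ax_refl A : ax_RBL_star (⊤ ⇒ A → A)
| ax_weak A : ax_RBL_star (A ⇒ ⊤ → A)
| ax_trans A B C : ax_RBL_star ((A → B) ∧ (B → C) ⇒ A → C).

Definition S_RBL (V : Type) : sequent V -> Prop := derivable (@ax_RBL V).
Definition S_RBL_star (V : Type) : sequent V -> Prop := derivable (@ax_RBL_star V).

(* Main.v *)
(** By residuation, (W_l) and (W_r) are interderivable with [⊤ ⇒ A → A] and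
    [A ⇒ ⊤ → A].  For transitivity from (RC), put [X := (A → B) ∧ (B → C)]: then
    [A ⋅ X ⇒ (A ⋅ X) ⋅ X ⇒ B ⋅ X ⇒ C].  Conversely, [B] entails both
    [A → A ⋅ B] and [A ⋅ B → (A ⋅ B) ⋅ B], hence by transitivity
    [A → (A ⋅ B) ⋅ B], which is (RC) up to residuation. *)

Require Import Defs.

(** The rules do not depend on the axiom set, so comparing two systems reduces to deriving the
    axioms of one in the other. *)
Lemma derivable_incl (V : Type) (Ax Ax' : sequent V -> Prop) :
  (forall s, Ax s -> derivable Ax' s) ->
  forall s, derivable Ax s -> derivable Ax' s.
Proof.
  intros H s D; induction D; eauto using derivable.
Qed.

(** Cut through [A' ⇒ (A' ⋅ B) ← B], the residuated identity. *)
Lemma prod_mono_l (V : Type) (Ax : sequent V -> Prop) (A A' B : formula V) :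
  derivable Ax (A ⇒ A')%rbl -> derivable Ax (A ⋅ B ⇒ A' ⋅ B)%rbl.
Proof.
  intros H; apply d_res_l_inv, (d_cut H), d_res_l, d_id.
Qed.

Lemma modus_ponens_and_l1 (V : Type) (Ax : sequent V -> Prop)
    (A B C : formula V) : derivable Ax (A ⋅ ((A → B) ∧ C) ⇒ B)%rbl.
Proof.
  apply d_res_r_inv, d_and_l1, d_id.
Qed.

Lemma modus_ponens_and_l2 (V : Type) (Ax : sequent V -> Prop)
    (A B C : formula V) : derivable Ax (A ⋅ (C ∧ (A → B)) ⇒ B)%rbl.
Proof.
  apply d_res_r_inv, d_and_l2, d_id.
Qed.

Lemma S_RBL_ax_star (V : Type) (s : sequent V) : ax_RBL_star s -> S_RBL s.
Proof.
  intros [A | A | A B C]; apply d_res_r.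
  - apply d_ax, ax_Wl.
  - apply d_ax, ax_Wr.
  - eapply d_cut; [apply d_ax, ax_RC |].
    (* The inner copy of the conjunction turns [A] into [B]; the outer copy remains for [B → C]. *)
    eapply d_cut; [apply prod_mono_l, modus_ponens_and_l1 |].
    apply modus_ponens_and_l2.
Qed.

Lemma S_RBL_star_ax (V : Type) (s : sequent V) : ax_RBL s -> S_RBL_star s.
Proof.
  intros [A | A | A B]; apply d_res_r_inv.
  - apply d_ax, ax_refl.
  - apply d_ax, ax_weak.
  - apply d_cut with ((A → A ⋅ B) ∧ (A ⋅ B → (A ⋅ B) ⋅ B))%rbl.
    (* Each conjunct residuates to an identity sequent. *)
    + apply d_and_r; apply d_res_r, d_id.
    + apply d_ax, ax_trans.
Qed.

Theorem theorem3 (V : Type) (A B : formula V) :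
  S_RBL (A ⇒ B)%rbl <-> S_RBL_star (A ⇒ B)%rbl.
Proof.
  split; apply derivable_incl.
  - apply S_RBL_star_ax.
  - apply S_RBL_ax_star.
Qed.
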